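(* Suppose there exist a sequence of positive reals $(a_n)_{n\in\mathbb{N}}$ and a random variable $W$ (possibly degenerate), with distribution function $F_W$, such that $\lim_{n\to\infty}a_n=+\infty$ and $\frac{\omega_n}{a_n}$ converges to $W$ in distribution as $n\to\infty$. Then for any $z\in\overline{\mathcal{D}}\setminus\{-\alpha,\alpha\}$ and any real number $s>0$ we have $$\lim_{n\to\infty}P\Bigl(\frac{1}{a_n}\log|U_n(z)+\alpha|<-s\Bigr)=F_W(-s)$$ and $$\lim_{n\to\infty}P\Bigl(\frac{1}{a_n}\log|U_n(z)-\alpha|<-s\Bigr)=1-F_W(s).$$
   Context: $\mathcal{D}$ is the open unit disk in $\mathbb{C}$ centered at $0$, $\overline{\mathcal{D}}$ its closure, $\partial\mathcal{D}$ the unit circle. Fix $\alpha\in\partial\mathcal{D}$. For $x\in(-1,1)$ let $q_{x,\alpha}(z)=\frac{z+x\alpha}{1+x\bar\alpha z}$ for $z\in\overline{\mathcal{D}}$. For $\gamma\in\mathbb{R}$ let $g_\gamma:=q_{x,\alpha}$ where $x\in(-1,1)$ is determined by $\gamma=\log\frac{1+x}{1-x}$. Let $(x_n)_{n\in\mathbb{N}}$ be a stationary and ergodic sequence of random variables with values in $(-1,1)$; put $\gamma_n=\log\frac{1+x_n}{1-x_n}$, $\omega_0=0$, $\omega_n=\sum_{i=1}^n\gamma_i$, and $U_n:=g_{\omega_n}$ for $n\in\mathbb{Z}_+=\mathbb{N}\cup\{0\}$.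
   Formalization: The first limit is asserted only for s>0 such that F_W is continuous at -s, and the second only for s>0 such that F_W is continuous at s; for arbitrary s>0 the claim fails (e.g. x_n constant and W degenerate). *)

(* Defs.v *)
From HB Require Import structures.
From mathcomp Require Import all_boot all_order all_algebra.
From mathcomp Require Import complex.
From mathcomp Require Import all_classical all_reals all_analysis.
From mathcomp Require Import measurable_realfun.
From mathcomp Require Import ring lra.

Set Implicit Arguments.
Unset Strict Implicit.
Unset Printing Implicit Defensive.

Import Order.TTheory GRing.Theory Num.Theory.
Import numFieldNormedType.Exports.

Local Open Scope classical_set_scope.
Local Open Scope ring_scope.
Local Open Scope complex_scope.

Section disk_maps.
Context {R : realType}.
Implicit Types (x c : R) (al z : R[i]).

(* q_{x,al}(z) = (z + x al) / (1 + x al^* z), given on all of R[i]; it is     *)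
(* only meant for |al| = 1, -1 < x < 1 and |z| <= 1, where the denominator    *)
(* vanishes nowhere.                                                          *)
Definition qmap x al z : R[i] := (z + x%:C * al) / (1 + x%:C * al^* * z).

Definition log_ratio x : R := ln ((1 + x) / (1 - x)).

(* The x in (-1, 1) with c = log ((1 + x) / (1 - x)); it exists by    *)
(* log_ratio_param and is unique by log_ratio_inj.                            *)
Definition log_ratio_inv c : R :=
  get [set x | -1 < x < 1 /\ c = log_ratio x].

Definition gmap c al z : R[i] := qmap (log_ratio_inv c) al z.

Lemma log_ratio_inj x y :
  -1 < x < 1 -> -1 < y < 1 -> log_ratio x = log_ratio y -> x = y.
Proof.
move=> /andP[x0 x1] /andP[y0 y1].
have hp (u : R) : -1 < u -> u < 1 -> (1 + u) / (1 - u) \is Num.pos.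
  by move=> u0 u1; rewrite posrE divr_gt0 ?subr_gt0// -ltrBlDl sub0r.
move=> /(ln_inj (hp _ x0 x1) (hp _ y0 y1))/eqP.
have x1N : 1 - x != 0 by rewrite subr_eq0 gt_eqF.
have y1N : 1 - y != 0 by rewrite subr_eq0 gt_eqF.
by rewrite eqr_div// => /eqP h; lra.
Qed.

Lemma log_ratio_param c : exists x, -1 < x < 1 /\ c = log_ratio x.
Proof.
have e0 := expR_gt0 c.
have d0 : 0 < expR c + 1 by rewrite addr_gt0.
exists ((expR c - 1) / (expR c + 1)); split.
  by rewrite ltr_pdivlMr// ltr_pdivrMr//; apply/andP; split; lra.
rewrite /log_ratio -[LHS]expRK; congr ln.
have dN : expR c + 1 != 0 by rewrite gt_eqF.
by field; rewrite dN/=; lra.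
Qed.

Lemma log_ratio_invP c :
  -1 < log_ratio_inv c < 1 /\ log_ratio (log_ratio_inv c) = c.
Proof. by have [? <-] := getPex (log_ratio_param c). Qed.

Lemma log_ratioK x : -1 < x < 1 -> log_ratio_inv (log_ratio x) = x.
Proof.
by move=> hx; have [h1 h2] := log_ratio_invP (log_ratio x); exact: log_ratio_inj.
Qed.

Lemma measurable_log_ratio : measurable_fun [set: R] log_ratio.
Proof.
have mV : measurable_fun [set: R] (fun x : R => x^-1).
  rewrite -(setvU [set 0]); apply/measurable_funU => //.
    exact: measurableC.
  split; last exact: measurable_fun_set1.
  apply: subspace_continuous_measurable_fun; first exact: measurableC.
  apply: continuous_in_subspaceT => x; rewrite inE/= => /eqP x0.
  exact: inv_continuous.
apply: measurableT_comp => //.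
apply: measurable_funM; first exact: measurable_funD.
by apply: (measurableT_comp mV); exact: measurable_funB.
Qed.

End disk_maps.

Section processes.
Context {d : measure_display} {T : measurableType d} {R : realType}.
Variable P : probability T R.

(* Product sigma-algebra of R^nat, generated by the coordinate maps.          *)
Definition seq_measurable : set (set (nat -> R)) :=
  <<s \bigcup_i preimage_set_system setT (fun u : nat -> R => u i) measurable >>.

Definition seq_shift (u : nat -> R) : nat -> R := fun i => u i.+1.

Definition stationary (x : nat -> {RV P >-> R}) : Prop :=
  forall A, seq_measurable A ->
    P [set t | A (seq_shift (x ^~ t))] = P [set t | A (x ^~ t)].

(* Every strictly shift-invariant event of the path space is trivial.         *)
Definition ergodic (x : nat -> {RV P >-> R}) : Prop :=
  forall A, seq_measurable A -> seq_shift @^-1` A = A ->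
    P [set t | A (x ^~ t)] = 0%E \/ P [set t | A (x ^~ t)] = 1%E.

(* x i stands for x_{i+1}, so that omega x n = gamma_1 + ... + gamma_n.        *)
Definition omega (x : nat -> {RV P >-> R}) (n : nat) (t : T) : R :=
  \sum_(i < n) log_ratio (x i t).

Lemma measurable_omega x n : measurable_fun [set: T] (omega x n).
Proof.
apply: measurable_sum => i; exact: measurableT_comp measurable_log_ratio _.
Qed.

HB.instance Definition _ x n :=
  isMeasurableFun.Build _ _ _ _ (omega x n) (measurable_omega x n).

Definition Umap (al : R[i]) (x : nat -> {RV P >-> R}) (n : nat) (z : R[i])
    (t : T) : R[i] :=
  gmap (omega x n t) al z.

(* The limit may live on another probability space.                           *)
Definition cvg_in_distribution (Y : nat -> {RV P >-> R})
    (d' : measure_display) (T' : measurableType d') (Q : probability T' R)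
    (W : {RV Q >-> R}) : Prop :=
  forall r, {for r, continuous (cdf W)} ->
    cdf (Y n) r @[n --> \oo] --> cdf W r.

End processes.

(* Main.v *)
(* Write x for the parameter of U_n, so that omega_n = log ((1 + x) / (1 - x)).
   Since |al| = 1, U_n(z) + al = (1 + x) (z + al) / (1 + x al^* z), and the
   modulus of the denominator stays between a positive constant and 2 because
   al^* z lies in the closed disk minus {-1, 1}.  Hence ln |U_n(z) + al| differs
   from min (omega_n, 0) by a bounded amount, which division by a_n makes
   negligible: the event differs from omega_n / a_n <= -s only through an
   arbitrarily small shift of the threshold, and the continuity points of F_W
   are dense.  The second limit follows from the first estimate through the
   symmetry q_{-x,-al} = q_{x,al}. *)
Require Import Defs.
From mathcomp Require Import all_boot all_order all_algebra.
From mathcomp Require Import complex.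
From mathcomp Require Import all_classical all_reals all_analysis.
From mathcomp Require Import measurable_realfun.
From mathcomp Require Import ring lra.
Import Order.TTheory GRing.Theory Num.Theory.
Import numFieldNormedType.Exports.
Local Open Scope classical_set_scope.
Local Open Scope ring_scope.
Local Open Scope complex_scope.

(** * Distribution functions: continuity points and squeezing *)

Lemma nondecreasing_continuity_point (R : realType) (F : R -> R) (a b : R) :
  nondecreasing_fun F -> a < b ->
  exists2 c, a < c < b & {for c, continuous F}.
Proof.
move=> ndF ab.
have [[c cab Nc]|H] := pselect (exists2 c, c \in `]a, b[ & ~ discontinuity F c).
  exists c => //.
  have cl : cvg (F x @[x --> c^'-]).
    apply: nondecreasing_at_left_is_cvgr; near=> x.
      by move=> u v _ _; exact: ndF.
    by exists (F c) => _ /= [u + <-]; rewrite in_itv/= => /andP[_ /ltW /ndF].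
  have cr : cvg (F x @[x --> c^'+]).
    apply: nondecreasing_at_right_is_cvgr; near=> x.
      by move=> u v _ _; exact: ndF.
    by exists (F c) => _ /= [u + <-]; rewrite in_itv/= => /andP[/ltW /ndF].
  have lr : lim (F x @[x --> c^'-]) = lim (F x @[x --> c^'+]).
    by apply/eqP; apply: contra_notT Nc.
  (* Monotonicity traps [F c] between the one-sided limits, which agree at [c]. *)
  have lE : lim (F x @[x --> c^'-]) = F c.
    apply/eqP; rewrite eq_le {2}lr; apply/andP; split.
      by apply: limr_le => //; near=> x; exact: ndF.
    by apply: limr_ge => //; near=> x; exact: ndF.
  apply/left_right_continuousP; split; first by rewrite -lE.
  by rewrite -lE lr.
(* Otherwise the whole interval consists of jumps of a monotone function; these are countable, hence
   null, while the interval has positive length. *)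
have dc : countable [set c | c \in (`]a, b[) /\ discontinuity F c].
  by apply: discontinuity_countable => u v _ _; exact: ndF.
have : (lebesgue_measure (`]a, b[ : set R) <= 0)%E.
  rewrite -(countable_lebesgue_measure0 dc) le_measure ?inE//.
    by apply: countable_measurable dc => c; exact: measurable_set1.
  move=> c cab; split => //; apply: contrapT => Nc; apply: H.
  by exists c.
by rewrite lebesgue_measure_itv/= lte_fin ab -EFinB lee_fin subr_le0 leNgt ab.
Unshelve. all: by end_near. Qed.

Lemma cdf_continuity_point d (T : measurableType d) (R : realType)
    (P : probability T R) (X : {RV P >-> R}) (a b : R) :
  a < b -> exists2 c, a < c < b & {for c, continuous (cdf X)}.
Proof.
move=> ab; have fX r : cdf X r \is a fin_num by exact: fin_num_measure.
have [u v uv|c cab cc] :=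
    nondecreasing_continuity_point R (fine \o cdf X) _ _ _ ab.
  by rewrite /= fine_le ?cdf_nondecreasing.
exists c => //; rewrite /prop_for/= /continuous_at -(fineK (fX c)).
by apply/fine_cvgP; split; [exact: nearW|exact: cc].
Qed.

(** The shifted thresholds [r - e] and [r + e] may be jumps of [cdf W], where nothing is known about
    the limit; so [p n] is squeezed between values at continuity points [c1 < r < c2] close to
    [r]. *)
Lemma cdf_sandwich_cvg (R : realType) (d : measure_display)
    (T : measurableType d) (P : probability T R) (Y : nat -> {RV P >-> R})
    (d' : measure_display) (T' : measurableType d') (Q : probability T' R)
    (W : {RV Q >-> R}) (p : nat -> \bar R) (r : R) :
  cvg_in_distribution Y W -> {for r, continuous (cdf W)} ->
  (forall e, 0 < e -> \forall n \near \oo,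
    (cdf (Y n) (r - e) <= p n <= cdf (Y n) (r + e))%E) ->
  p n @[n --> \oo] --> cdf W r.
Proof.
move=> YW cr sw.
have fW u : cdf W u \is a fin_num by exact: fin_num_measure.
have fY n u : cdf (Y n) u \is a fin_num by exact: fin_num_measure.
have fcvg (f : nat -> \bar R) u : f n @[n --> \oo] --> cdf W u ->
    fine (f n) @[n --> \oo] --> fine (cdf W u).
  by rewrite -{1}(fineK (fW u)) => /fine_cvgP[].
have fp : \forall n \near \oo, p n \is a fin_num.
  have := sw 1 ltr01; apply: filterS => n /andP[l u].
  by rewrite fin_numElt (lt_le_trans _ l) ?(le_lt_trans u) ?ltNye_eq
    ?ltey_eq ?fY.
rewrite -(fineK (fW r)); apply/fine_cvgP; split => //.
apply/cvgrPdist_lt => e e0.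
have cfr : fine (cdf W x) @[x --> r] --> fine (cdf W r).
  move: cr; rewrite /prop_for/= /continuous_at -{1}(fineK (fW r)).
  by move=> /fine_cvgP[].
have /cvgrPdist_lt/(_ (e / 2)) := cfr; rewrite divr_gt0// => /(_ isT).
case=> dl /= dl0 dlP.
have [c1 /andP[c1l c1r] cc1] :=
  cdf_continuity_point _ _ _ _ W (r - dl) r ltac:(lra).
have [c2 /andP[c2l c2r] cc2] :=
  cdf_continuity_point _ _ _ _ W r (r + dl) ltac:(lra).
have := dlP c1; rewrite /ball_/= ltr_norml => /(_ ltac:(lra)) h1.
have := dlP c2; rewrite /ball_/= ltr_norml => /(_ ltac:(lra)) h2.
have /fcvg/cvgrPdist_lt/(_ (e / 2)) := YW _ cc1.
rewrite divr_gt0// => /(_ isT) n1.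
have /fcvg/cvgrPdist_lt/(_ (e / 2)) := YW _ cc2.
rewrite divr_gt0// => /(_ isT) n2.
move: h1 h2; rewrite !ltr_norml => h1 h2.
(* With this shift, [c1 <= r - h] and [r + h <= c2]. *)
pose h := Num.min (r - c1) (c2 - r).
have := sw h; rewrite lt_min !subr_gt0 c1r c2l => /(_ isT) n3.
near=> n.
have : `|fine (cdf W c1) - fine (cdf (Y n) c1)| < e / 2 by near: n.
have : `|fine (cdf W c2) - fine (cdf (Y n) c2)| < e / 2 by near: n.
have pn : p n \is a fin_num by near: n.
have /andP[n4 n5] : (cdf (Y n) (r - h)%R <= p n <= cdf (Y n) (r + h)%R)%E
  by near: n.
have : fine (cdf (Y n) c1) <= fine (p n).
  rewrite fine_le//; apply: le_trans n4; apply: cdf_nondecreasing.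
  by rewrite lerBrDl -lerBrDr ge_min lexx.
have : fine (p n) <= fine (cdf (Y n) c2).
  rewrite fine_le//; apply: le_trans n5 _; apply: cdf_nondecreasing.
  by rewrite -lerBrDl ge_min lexx orbT.
rewrite /= !ltr_norml; lra.
Unshelve. all: by end_near. Qed.

(** * Pointwise estimate of the logarithm of the modulus for a fixed point of the disk *)

Section disk_map_estimate.
Context {R : realType}.
Implicit Types (x c : R) (al z w : R[i]).
(** The norm [|w|] is an element of [R[i]]; [normc] is the real-valued modulus, to which [ln]
    applies. *)
Local Notation normc := (@Normc.normc R).

Lemma normc_gt0 w : w != 0 -> 0 < normc w.
Proof.
move=> w0; rewrite lt_neqAle eq_sym; apply/andP; split.
  by apply: contra w0 => /eqP/Normc.eq0_normc ->.
by case: w {w0} => u v; exact: sqrtr_ge0.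
Qed.

Lemma mulcJ_norm1 al : `|al| = 1 -> al * al^* = 1.
Proof. by move=> h; rewrite -sqr_normc h expr1n. Qed.

Lemma qmapN x al z : qmap (- x) (- al) z = qmap x al z.
Proof. by rewrite /qmap !rmorphN /= !mulrNN. Qed.

Lemma log_ratioN x : -1 < x < 1 -> log_ratio (- x) = - log_ratio x.
Proof.
by move=> /andP[x0 x1]; rewrite /log_ratio opprK !ln_div ?posrE; lra.
Qed.

Lemma log_ratio_invN c : log_ratio_inv (- c) = - log_ratio_inv c.
Proof.
have [x1 {1}<-] := log_ratio_invP c.
by rewrite -log_ratioN// log_ratioK//; lra.
Qed.

Lemma gmapN c al z : gmap (- c) (- al) z = gmap c al z.
Proof. by rewrite /gmap log_ratio_invN qmapN. Qed.

Lemma qmapD x al z : `|al| = 1 -> 1 + x%:C * al^* * z != 0 ->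
  qmap x al z + al = (1 + x)%:C * (z + al) / (1 + x%:C * al^* * z).
Proof.
move=> /mulcJ_norm1 al1 nz; rewrite /qmap rmorphD rmorph1.
apply: (mulIf nz); rewrite mulrDl !divfK//.
(* Since [al * al^* = 1], the numerators add up to [z + x al + al + x z], which factors as
   [(1 + x) (z + al)]. *)
have -> : al * (1 + x%:C * al^* * z) = al + x%:C * z * (al * al^*) by ring.
by rewrite al1; ring.
Qed.

Lemma sqr_Re_Im_le1 w :
  `|w| <= 1 -> complex.Re w ^+ 2 + complex.Im w ^+ 2 <= 1.
Proof.
rewrite normc_def -(rmorph1 (real_complex R)) lecR -{1}sqrtr1.
by rewrite ler_sqrt.
Qed.

(** A nonzero imaginary part forces [(Re w)^2 < 1]; a real [w] lies in [-1, 1] with both endpoints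
    excluded. *)
Lemma Re_lt1 w : `|w| <= 1 -> w != -1 -> w != 1 -> -1 < complex.Re w < 1.
Proof.
move=> /sqr_Re_Im_le1; case: w => u v /= uv; rewrite !eq_complex/= oppr0.
have [v0 wN1 w1|v0 _ _] := eqVneq v 0.
  move: wN1 w1; rewrite !andbT => uN1 u1; move: uv; rewrite v0 expr0n/= addr0.
  move=> uu; have /andP[] : -1 <= u <= 1 by apply/andP; split; nra.
  by rewrite !le_eqVlt (negPf u1) eq_sym (negPf uN1)/= => -> ->.
have := exprn_even_gt0 (n := 2) v.
rewrite v0/= => /(_ isT) => v2; apply/andP; split; nra.
Qed.

Lemma normc_1DM x w : normc (1 + x%:C * w) =
  Num.sqrt ((1 + x * complex.Re w) ^+ 2 + (x * complex.Im w) ^+ 2).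
Proof. by case: w => u v; simpc. Qed.

(* [1 + x Re w] is a convex combination of [1 - Re w] and [1 + Re w]. *)
Lemma normc_1DM_bounds x w : -1 < x < 1 -> `|w| <= 1 ->
  Num.min (1 - complex.Re w) (1 + complex.Re w) <= normc (1 + x%:C * w) <= 2.
Proof.
move=> /andP[x0 x1] /sqr_Re_Im_le1; rewrite normc_1DM.
move: (complex.Re w) (complex.Im w) => u v uv; apply/andP; split.
  rewrite (@le_trans _ _ (1 + x * u))//.
    by rewrite ge_min; apply/orP; have [u0|u0] := leP 0 u; [left|right]; nra.
  rewrite (le_trans (ler_norm _))// -sqrtr_sqr ler_sqrt ?lerDl ?sqr_ge0//.
  by rewrite addr_ge0 ?sqr_ge0.
rewrite -[leRHS]ger0_norm// -sqrtr_sqr ler_sqrt ?sqr_ge0//.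
have : x ^+ 2 * (u ^+ 2 + v ^+ 2) <= 1.
  by rewrite mulr_ile1 ?addr_ge0 ?sqr_ge0//; nra.
(* The squared modulus is [1 + 2 x u + x^2 (u^2 + v^2)], and [2 x u <= x^2 + u^2 <= 2], so it is at
   most 4. *)
have := sqr_ge0 (x - u); have := sqr_ge0 v; nra.
Qed.

(** For [x >= 0] the minimum is 0 and [ln (1 + x)] lies in [0, ln 2]; for [x < 0] the minimum is
    [ln (1 + x) - ln (1 - x)], and [ln (1 - x)] lies in [0, ln 2]. *)
Lemma ln_1D_bounds x : -1 < x < 1 ->
  Num.min (log_ratio x) 0 <= ln (1 + x) <= Num.min (log_ratio x) 0 + ln 2.
Proof.
move=> x1; rewrite /log_ratio ln_div ?posrE; try lra.
have [x0|x0] := leP 0 x.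
  have : ln (1 - x) <= 0 by apply: ln_le0; lra.
  have : 0 <= ln (1 + x) by apply: ln_ge0; lra.
  have : ln (1 + x) <= ln 2 by rewrite ler_ln ?posrE; lra.
  by move=> ? ? ?; rewrite min_r; lra.
have : ln (1 + x) <= 0 by apply: ln_le0; lra.
have : 0 <= ln (1 - x) by apply: ln_ge0; lra.
have : ln (1 - x) <= ln 2 by rewrite ler_ln ?posrE; lra.
by move=> ? ? ?; rewrite min_l; lra.
Qed.

Lemma normc_real x : 0 <= x -> normc x%:C = x.
Proof. by move=> x0; rewrite /= expr0n addr0 sqrtr_sqr ger0_norm. Qed.

(** Multiplication by [al^*] is the rotation of the disk that takes [al] to 1 and [- al] to -1. *)
Lemma conj_mul_disk al z : `|al| = 1 -> `|z| <= 1 -> z != - al -> z != al ->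
  `|al^* * z| <= 1 /\ -1 < complex.Re (al^* * z) < 1.
Proof.
move=> /[dup] al1 /mulcJ_norm1 alJ z1 zNal zal.
have w1 : `|al^* * z| <= 1 by rewrite normrM normcJ al1 mul1r.
have zE : z = al * (al^* * z) by rewrite mulrA alJ mul1r.
split=> //; apply: Re_lt1 => //.
- by apply: contra zNal => /eqP wE; rewrite zE wE mulrN1.
- by apply: contra zal => /eqP wE; rewrite zE wE mulr1.
Qed.

Lemma ln_normc_gmapD c al z : `|al| = 1 -> `|z| <= 1 ->
  z != - al -> z != al ->
  ln (normc (gmap c al z + al)) = ln (1 + log_ratio_inv c) + ln (normc (z + al))
    - ln (normc (1 + (log_ratio_inv c)%:C * (al^* * z))).
Proof.
move=> al1 z1 zNal zal; have [x1 _] := log_ratio_invP c.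
have [w1 wRe] := conj_mul_disk al z al1 z1 zNal zal.
have d0 : 0 < normc (1 + (log_ratio_inv c)%:C * (al^* * z)).
  have /andP[+ _] := normc_1DM_bounds _ _ x1 w1.
  by apply: lt_le_trans; rewrite lt_min; lra.
have nz : 1 + (log_ratio_inv c)%:C * al^* * z != 0.
  by apply/eqP => nz0; move: d0; rewrite mulrA nz0 Normc.normc0 ltxx.
have n0 : 0 < normc (z + al) by rewrite normc_gt0// addr_eq0.
rewrite /gmap qmapD// !Normc.normcM Normc.normcV normc_real -?mulrA; last lra.
rewrite mulrA -lnM ?posrE//; last lra.
by rewrite -ln_div ?posrE// mulr_gt0//; lra.
Qed.

Lemma ln_normc_gmapD_bound al z : `|al| = 1 -> `|z| <= 1 ->
  z != - al -> z != al ->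
  exists K, forall c, `|ln (normc (gmap c al z + al)) - Num.min c 0| <= K.
Proof.
move=> al1 z1 zNal zal.
have [w1 wRe] := conj_mul_disk al z al1 z1 zNal zal.
(* A lower bound for the modulus of the denominator that is positive and independent of [c]. *)
pose dl := Num.min (1 - complex.Re (al^* * z)) (1 + complex.Re (al^* * z)).
have dl0 : 0 < dl by rewrite lt_min; lra.
(* One [ln 2] suffices: the error of [ln (1 + x)] uses it in the upper bound, the denominator in the
   lower one. *)
exists (`|ln (normc (z + al))| + `|ln dl| + ln 2) => c.
rewrite ln_normc_gmapD//; have [x1 xc] := log_ratio_invP c.
have := ln_1D_bounds _ x1; rewrite xc => /andP[l1 l2].
have /andP[d1 d2] := normc_1DM_bounds _ _ x1 w1.
have d0 := lt_le_trans dl0 d1.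
have {d1} : ln dl <= ln (normc (1 + (log_ratio_inv c)%:C * (al^* * z))).
  by rewrite ler_ln ?posrE.
have {d2} : ln (normc (1 + (log_ratio_inv c)%:C * (al^* * z))) <= ln 2.
  by rewrite ler_ln ?posrE.
have := ler_norm (ln (normc (z + al))).
have := ler_norm (- ln (normc (z + al))).
have := ler_norm (ln dl).
have := ler_norm (- ln dl).
have : 0 <= ln 2 :> R by apply: ln_ge0; lra.
rewrite !normrN ler_norml; lra.
Qed.

(** Inherited from the strict monotonicity of [log_ratio]; it makes [log_ratio_inv], which is
    defined by choice, measurable. *)
Lemma le_log_ratio_inv : nondecreasing_fun (@log_ratio_inv R).
Proof.
move=> c c' cc'; rewrite leNgt; apply/negP => x'x.
have [/andP[x0 x1] xc] := log_ratio_invP c.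
have [/andP[x0' x1'] xc'] := log_ratio_invP c'.
have : log_ratio (log_ratio_inv c') < log_ratio (log_ratio_inv c).
  by rewrite /log_ratio !ln_div ?posrE ?ltrD ?ltrN2 ?ltr_ln ?posrE; lra.
by rewrite xc xc' ltNge cc'.
Qed.

Lemma measurable_ln_normc_gmapD al z : `|al| = 1 -> `|z| <= 1 ->
  z != - al -> z != al ->
  measurable_fun [set: R] (fun c => ln (normc (gmap c al z + al))).
Proof.
move=> al1 z1 zNal zal.
have mx : measurable_fun [set: R] (@log_ratio_inv R).
  by apply: nondecreasing_measurable => //; exact: le_log_ratio_inv.
under eq_fun do rewrite ln_normc_gmapD// normc_1DM.
apply: measurable_funB.
  apply: measurable_funD => //.
  by apply: measurableT_comp => //; exact: measurable_funD.
have msqrt : measurable_fun [set: R] (@Num.sqrt R).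
  by apply: continuous_measurable_fun; exact: sqrt_continuous.
apply: measurableT_comp; first exact: measurable_ln.
apply: measurableT_comp; first exact: msqrt.
apply: measurable_funD; apply: measurable_funX.
  by apply: measurable_funD => //; exact: measurable_funM.
exact: measurable_funM.
Qed.

End disk_map_estimate.

(** * From the pointwise estimate to tail probabilities *)

Lemma cdf_le_prob d (T : measurableType d) (R : realType)
    (P : probability T R) (X : {RV P >-> R}) (r : R) (A : set T) :
  measurable A -> (forall t, X t <= r -> A t) -> (cdf X r <= P A)%E.
Proof.
move=> mA XA.
by apply: (le_measure P); rewrite ?inE//; exact: measurable_funPTI.
Qed.

Lemma prob_le_cdf d (T : measurableType d) (R : realType)
    (P : probability T R) (X : {RV P >-> R}) (r : R) (A : set T) :
  measurable A -> (forall t, A t -> X t <= r) -> (P A <= cdf X r)%E.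
Proof.
move=> mA AX.
by apply: (le_measure P); rewrite ?inE//; exact: measurable_funPTI.
Qed.

(** Here [b] plays the role of [1 / a_n]. The number [b * l] is within [K * b] of [min (c * b, 0)].
    The condition [K * b < e] absorbs this error in the shift of the threshold, and [K * b < s]
    rules out [b * l < - s] when [c] is nonnegative. *)
Lemma scaled_min0_tail (R : realFieldType) (b c l K s e : R) :
  0 < b -> `|l - Num.min c 0| <= K -> K * b < e -> K * b < s ->
  (c * b <= - s - e -> b * l < - s) /\ (b * l < - s -> c * b < - s + e).
Proof.
move=> b0; rewrite ler_norml => /andP[lK Kl] Ke Ks.
have bl : b * l <= b * Num.min c 0 + K * b by nra.
have lb : b * Num.min c 0 <= b * l + K * b by nra.
case: (leP c 0) => c0 in bl lb *; split; nra.
Qed.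

Section tails.
Context {R : realType} {d : measure_display} {T : measurableType d}.
Variables (P : probability T R) (S : nat -> {RV P >-> R}) (a : nat -> R).
Hypothesis a_cvgy : a n @[n --> \oo] --> +oo.
Context {d' : measure_display} {T' : measurableType d'}.
Variables (Q : probability T' R) (W : {RV Q >-> R}).
Hypothesis SW :
  cvg_in_distribution (fun n => (a n)^-1 \o* S n : {RV P >-> R}) W.
(** [L] stands for the logarithm of the modulus as a function of the value of [omega x n], which is
    [S n] in the application. *)
Variables (L : R -> R) (K s : R).
Hypotheses (mL : measurable_fun [set: R] L) (s0 : 0 < s).

Let A n := [set t | (a n)^-1 * L (S n t) < - s].

Let measurable_A n : measurable (A n).
Proof.
have mf : measurable_fun [set: T] (fun t => (a n)^-1 * L (S n t)).
  by apply: measurable_funM => //; exact: measurableT_comp.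
rewrite (_ : A n = [set: T] `&`
    (fun t => (a n)^-1 * L (S n t)) @^-1` `]-oo, - s[).
  exact: mf.
by rewrite setTI; apply/seteqP; split => t; rewrite /A/= in_itv.
Qed.

Let near_scale e : 0 < e ->
  \forall n \near \oo, [/\ 0 < (a n)^-1, K * (a n)^-1 < e & K * (a n)^-1 < s].
Proof.
move=> e0; near=> n.
have an : 0 < a n by near: n; exact: (cvgry_gt a_cvgy).
rewrite invr_gt0; split => //.
- rewrite ltr_pdivrMr// mulrC -ltr_pdivrMr//.
  by near: n; exact: (cvgry_gt a_cvgy).
- rewrite ltr_pdivrMr// mulrC -ltr_pdivrMr//.
  by near: n; exact: (cvgry_gt a_cvgy).
Unshelve. all: by end_near. Qed.

Lemma cvg_lower_tail : (forall c, `|L c - Num.min c 0| <= K) ->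
  {for - s, continuous (cdf W)} ->
  P [set t | (a n)^-1 * L (S n t) < - s] @[n --> \oo] --> cdf W (- s).
Proof.
move=> LK cs; apply: cdf_sandwich_cvg SW cs _ => e e0.
near=> n.
have [b0 Ke Ks] : [/\ 0 < (a n)^-1, K * (a n)^-1 < e & K * (a n)^-1 < s].
  by near: n; exact: near_scale.
have tail t := scaled_min0_tail _ _ _ _ _ _ _ b0 (LK (S n t)) Ke Ks.
apply/andP; split.
- by apply: cdf_le_prob => [|t /(tail t).1//]; exact: measurable_A.
- by apply: prob_le_cdf => [|t /(tail t).2/ltW//]; exact: measurable_A.
Unshelve. all: by end_near. Qed.

(** The event is now close to [S n / a n >= s], so its complement is the one to squeeze between
    values of the distribution function. *)
Lemma cvg_upper_tail : (forall c, `|L c - Num.min (- c) 0| <= K) ->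
  {for s, continuous (cdf W)} ->
  P [set t | (a n)^-1 * L (S n t) < - s] @[n --> \oo] --> (1 - cdf W s)%E.
Proof.
move=> LK cs.
have fW : cdf W s \is a fin_num by exact: fin_num_measure.
have AE n : P (A n) = (1 - P (~` A n))%E.
  by rewrite -probability_setC ?setCK//; exact: measurableC.
rewrite -/(A _); under eq_fun do rewrite -/(A _) AE.
apply: cvgeB; [by rewrite fin_num_adde_defl// fin_numN|exact: cvg_cst|].
apply: cdf_sandwich_cvg SW cs _ => e e0.
near=> n.
have [b0 Ke Ks] : [/\ 0 < (a n)^-1, K * (a n)^-1 < e & K * (a n)^-1 < s].
  by near: n; exact: near_scale.
(* The estimate is applied to [- S n t]; its two implications are used in contrapositive form. *)
have tail t := scaled_min0_tail _ _ _ _ _ _ _ b0 (LK (S n t)) Ke Ks.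
apply/andP; split.
- apply: cdf_le_prob => [|t /= St /(tail t).2]; last by lra.
  exact/measurableC/measurable_A.
- apply: prob_le_cdf => [|t /= NA]; first exact/measurableC/measurable_A.
  by rewrite leNgt; apply/negP => St; apply: NA; apply: (tail t).1; lra.
Unshelve. all: by end_near. Qed.

End tails.

(** * The two limits for the random disk maps *)

Theorem theorem8 (R : realType) (d : measure_display) (T : measurableType d)
    (P : probability T R) (al : R[i]) (hal : `|al| = 1)
    (x : nat -> {RV P >-> R}) (hx : forall i t, -1 < x i t < 1)
    (hstat : stationary x) (herg : ergodic x)
    (a : nat -> R) (ha0 : forall n, (0 < n)%N -> 0 < a n)
    (ha : a n @[n --> \oo] --> +oo)
    (d' : measure_display) (T' : measurableType d') (Q : probability T' R)
    (W : {RV Q >-> R})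
    (hW : cvg_in_distribution (fun n => (a n)^-1 \o* omega x n : {RV P >-> R}) W)
    (z : R[i]) (hz : `|z| <= 1) (hz1 : z != - al) (hz2 : z != al)
    (s : R) (hs : 0 < s) :
  ({for - s, continuous (cdf W)} ->
     P [set t | (a n)^-1 * ln (Normc.normc (Umap al x n z t + al)) < - s]
       @[n --> \oo] --> cdf W (- s)) /\
  ({for s, continuous (cdf W)} ->
     P [set t | (a n)^-1 * ln (Normc.normc (Umap al x n z t - al)) < - s]
       @[n --> \oo] --> (1 - cdf W s)%E).
Proof.
have halN : `|- al| = 1 by rewrite normrN.
have hz1N : z != - - al by rewrite opprK.
split => cs.
  have [K LK] := ln_normc_gmapD_bound _ _ hal hz hz1 hz2.
  have mL := measurable_ln_normc_gmapD _ _ hal hz hz1 hz2.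
  exact: (cvg_lower_tail _ _ _ ha _ _ hW _ _ _ mL hs LK cs).
have [K LK] := ln_normc_gmapD_bound _ _ halN hz hz1N hz1.
have mL := measurable_ln_normc_gmapD _ _ halN hz hz1N hz1.
(* Negating both [c] and [al] leaves [gmap] unchanged, so the estimate for [- al] at [- c] controls
   the distance to [al] by [min (- c, 0)]. *)
pose L c := ln (Normc.normc (gmap (- c) (- al) z + - al)).
have mLN : measurable_fun [set: R] L by exact: (measurableT_comp mL).
have LE n t : ln (Normc.normc (Umap al x n z t - al)) = L (omega x n t).
  by rewrite /L gmapN.
under eq_fun do under eq_set do rewrite LE.
exact: (cvg_upper_tail _ _ _ ha _ _ hW _ _ _ mLN hs (fun c => LK (- c)) cs).
Qed.
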